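(* Let $\Phi=(G,\varphi)$ be a $\mathbb{T}$-gain graph on a connected graph $G$. Then $\Phi$ is distance compatible if and only if every block of $\Phi$ (i.e. every block $B$ of $G$ with the restriction of $\varphi$ to the oriented edges of $B$) is distance compatible.
   Context: $\mathbb{T}=\{z\in\mathbb{C}:|z|=1\}$. A $\mathbb{T}$-gain graph $\Phi=(G,\varphi)$ on a simple graph $G$ assigns to each oriented edge $\overrightarrow{e}_{i,j}$ an element $\varphi(\overrightarrow{e}_{i,j})\in\mathbb{T}$ with $\varphi(\overrightarrow{e}_{j,i})=\varphi(\overrightarrow{e}_{i,j})^{-1}$. The gain of an oriented path is the product of the gains of its consecutive oriented edges. $d(s,t)$ is the graph distance. $\mathcal{P}(s,t)$ is the set of oriented shortest paths from $s$ to $t$; $\mathcal{P}^{\max}(s,t)$ (resp. $\mathcal{P}^{\min}(s,t)$) is the set of those whose gain has maximum (resp. minimum) real part in $\mathcal{P}(s,t)$. For a total order $<$ on the vertex set and $s<t$, $\varphi^{<}_{\max}(s,t)$ is the gain of a path in $\mathcal{P}^{\max}(s,t)$ with maximum imaginary part of gain among paths in $\mathcal{P}^{\max}(s,t)$, and $\varphi^{<}_{\max}(t,s)=\overline{\varphi^{<}_{\max}(s,t)}$; $\varphi^{<}_{\min}(s,t)$ is the gain of a path in $\mathcal{P}^{\min}(s,t)$ with minimum imaginary part of gain among paths in $\mathcal{P}^{\min}(s,t)$, and $\varphi^{<}_{\min}(t,s)=\overline{\varphi^{<}_{\min}(s,t)}$. The gain distance matrices are $D^{\max}_{<}=(\varphi^{<}_{\max}(v_i,v_j)d(v_i,v_j))$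 and $D^{\min}_{<}=(\varphi^{<}_{\min}(v_i,v_j)d(v_i,v_j))$. A $\mathbb{T}$-gain graph is distance compatible if $D^{\max}_{<}=D^{\min}_{<}$ for the standard order $v_1<\dots<v_n$ of its vertices (equivalently, for any total order). A block of $G$ is a maximal connected subgraph without a cut vertex. *)

(* Defs.v *)
From HB Require Import structures.
From mathcomp Require Import all_boot all_order all_algebra.
From mathcomp Require Import reals complex.

Set Implicit Arguments.
Unset Strict Implicit.
Unset Printing Implicit Defensive.

Import Order.TTheory GRing.Theory Num.Theory.
Local Open Scope ring_scope.

(* Simple graphs whose vertex set is a subset of a fixed finite type, so that a
   graph and its subgraphs live in the same type. *)
Record sgraph (V : finType) := SGraph {
  verts : {set V};
  adj : rel V;
  adj_sym : symmetric adj;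
  adj_irr : irreflexive adj;
  adj_verts : forall x y, adj x y -> x \in verts }.

Section Graph.
Variable V : finType.
Implicit Types (G H K : sgraph V) (s t v x y : V) (p : seq V).

Definition subgraph H G : Prop :=
  verts H \subset verts G /\ subrel (adj H) (adj G).

Definition gconnected G : Prop :=
  verts G != set0 /\ {in verts G &, forall x y, connect (adj G) x y}.

Definition del_adj G v : rel V :=
  [rel x y | [&& x != v, y != v & adj G x y]].

Lemma del_adj_sym G v : symmetric (del_adj G v).
Proof. by move=> x y; rewrite /del_adj /= adj_sym andbCA. Qed.

Lemma del_adj_irr G v : irreflexive (del_adj G v).
Proof. by move=> x; rewrite /del_adj /= adj_irr !andbF. Qed.

Lemma del_adj_verts G v x y : del_adj G v x y -> x \in verts G :\ v.
Proof.
by case/and3P=> xv _ /adj_verts xG; rewrite in_setD1 xv.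
Qed.

Definition del_vertex G v : sgraph V :=
  SGraph (del_adj_sym G v) (@del_adj_irr G v) (@del_adj_verts G v).

(* v separates two other vertices of its component; in particular the
   one-vertex graph has no cut vertex. *)
Definition cut_vertex G v : Prop :=
  v \in verts G /\
  exists x y, [/\ x \in verts (del_vertex G v), y \in verts (del_vertex G v),
                  connect (adj G) x y & ~~ connect (adj (del_vertex G v)) x y].

Definition nonseparable G : Prop :=
  gconnected G /\ forall v, ~ cut_vertex G v.

(* Maximality is among all subgraphs, not only the induced ones. *)
Definition block B G : Prop :=
  [/\ subgraph B G, nonseparable B &
      forall H, subgraph H G -> nonseparable H -> subgraph B H ->
        subgraph H B].

(* The path s = x_0, x_1, ..., x_k = t is encoded by p = [:: x_1; ...; x_k]. *)
Definition is_path G s t p : bool :=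
  [&& s \in verts G, path (adj G) s p, last s p == t & uniq (s :: p)].

(* Takes the junk value #|V| when t is not reachable from s. *)
Definition dist G s t : nat :=
  find (fun k => [exists p : k.-tuple V, is_path G s t p]) (iota 0 #|V|).

Definition shortest_paths G s t : {set (dist G s t).-tuple V} :=
  [set p : (dist G s t).-tuple V | is_path G s t p].

End Graph.

(* Only the values of gain on adjacent pairs are meaningful. *)
Record gain_graph (R : realType) (V : finType) := GainGraph {
  ggraph :> sgraph V;
  gain : V -> V -> R[i];
  gain_norm : forall x y, adj ggraph x y -> `|gain x y| = 1;
  gain_inv : forall x y, adj ggraph x y -> gain y x = (gain x y)^-1 }.

Lemma subgain_norm (R : realType) (V : finType) (Phi : gain_graph R V)
    (H : sgraph V) (sH : subgraph H Phi) x y :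
  adj H x y -> `|gain Phi x y| = 1.
Proof. by move=> /(proj2 sH)/gain_norm. Qed.

Lemma subgain_inv (R : realType) (V : finType) (Phi : gain_graph R V)
    (H : sgraph V) (sH : subgraph H Phi) x y :
  adj H x y -> gain Phi y x = (gain Phi x y)^-1.
Proof. by move=> /(proj2 sH)/gain_inv. Qed.

Definition subgain (R : realType) (V : finType) (Phi : gain_graph R V)
    (H : sgraph V) (sH : subgraph H Phi) : gain_graph R V :=
  GainGraph (subgain_norm sH) (subgain_inv sH).

Section GainDistance.
Variables (R : realType) (V : finType) (Phi : gain_graph R V).
Implicit Types (s t : V) (p : seq V) (lt : rel V).

Definition path_gain s p : R[i] :=
  \prod_(g <- pairmap (gain Phi) s p) g.

Definition re_gain s p : R := complex.Re (path_gain s p).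
Definition im_gain s p : R := complex.Im (path_gain s p).

Definition Pmax s t : {set (dist Phi s t).-tuple V} :=
  [set p in shortest_paths Phi s t |
    [forall q in shortest_paths Phi s t, re_gain s q <= re_gain s p]].

Definition Pmin s t : {set (dist Phi s t).-tuple V} :=
  [set p in shortest_paths Phi s t |
    [forall q in shortest_paths Phi s t, re_gain s p <= re_gain s q]].

(* The chosen path is not unique, but its gain is. The default 0 is reached
   only when t is not reachable from s. *)
Definition max_gain s t : R[i] :=
  if [pick p in Pmax s t | [forall q in Pmax s t, im_gain s q <= im_gain s p]]
  is Some p then path_gain s p else 0.

Definition min_gain s t : R[i] :=
  if [pick p in Pmin s t | [forall q in Pmin s t, im_gain s p <= im_gain s q]]
  is Some p then path_gain s p else 0.

Definition phi_max lt s t : R[i] :=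
  if lt s t then max_gain s t else Num.conj (max_gain t s).

Definition phi_min lt s t : R[i] :=
  if lt s t then min_gain s t else Num.conj (min_gain t s).

(* Rows and columns are indexed by the vertices of Phi, in enumeration order. *)
Definition Dmax lt : 'M[R[i]]_#|verts Phi| :=
  \matrix_(i, j) (phi_max lt (enum_val i) (enum_val j)
                  * (dist Phi (enum_val i) (enum_val j))%:R).

Definition Dmin lt : 'M[R[i]]_#|verts Phi| :=
  \matrix_(i, j) (phi_min lt (enum_val i) (enum_val j)
                  * (dist Phi (enum_val i) (enum_val j))%:R).

End GainDistance.

Definition std_order (n : nat) : rel 'I_n := fun i j => (i < j)%N.

Definition distance_compatible (R : realType) (n : nat)
    (Phi : gain_graph R 'I_n) : Prop :=
  Dmax Phi (@std_order n) = Dmin Phi (@std_order n).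

(* Main.v *)
(** Distance compatibility says exactly that any two shortest paths with the
    same ends have the same gain.  A block contains every simple path of [G]
    joining two of its vertices, because adding such a path to a nonseparable
    subgraph keeps it nonseparable; so the distances and the shortest paths of a
    block are those of [G], which gives one direction.  For the other, take two
    shortest paths from [s] to [t], by induction on their length.  If they share
    an inner vertex, split both there.  Otherwise the second one followed by the
    reverse of the first one, up to its first inner vertex [x], is a simple path
    from [s] to [x] through [t], so [t] lies in the block of the edge [sx], and
    the block decides. *)

Require Import Defs.
From mathcomp Require Import all_boot all_order all_algebra.
From mathcomp Require Import reals complex boolp.

Set Implicit Arguments.
Unset Strict Implicit.
Unset Printing Implicit Defensive.

Import Order.TTheory GRing.Theory Num.Theory.

Section Connected.
Variable V : finType.
Implicit Types (e : rel V) (A B : {set V}).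

Definition connected_on e A : Prop := {in A &, forall x y, connect e x y}.

Lemma connected_on_subrel e e' A :
  subrel e e' -> connected_on e A -> connected_on e' A.
Proof.
move=> ee' conA x y xA yA; apply: connect_sub (conA x y xA yA) => a b /ee'.
exact: connect1.
Qed.

Lemma connected_on_attach e A B :
    symmetric e -> connected_on e A ->
    {in B, forall x, exists2 a, a \in A & connect e x a} ->
  connected_on e B.
Proof.
move=> sym_e conA BA x y /BA[a aA xa] /BA[b bA yb].
apply: connect_trans xa (connect_trans (conA a b aA bA) _).
by rewrite (sym_connect_sym sym_e).
Qed.

End Connected.

Section Subgraphs.
Variable V : finType.
Implicit Types (G H K : sgraph V) (s v x y : V) (p : seq V).

Lemma adj_vertsr G x y : adj G x y -> y \in verts G.
Proof. by rewrite adj_sym => /adj_verts. Qed.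

Lemma path_verts G s p :
  s \in verts G -> path (adj G) s p -> {subset s :: p <= verts G}.
Proof.
move=> sG sp x; rewrite inE => /predU1P[->//|]; elim: p s sp {sG} => //= y p IHp s.
by case/andP=> /adj_vertsr yG /IHp xp; rewrite inE => /predU1P[->|].
Qed.

(* A subgraph as a set of vertices and arcs, so that maximal subgraphs are
   maximal sets. *)
Definition cells G : {set V + V * V} :=
  [set c | match c with inl x => x \in verts G | inr e => adj G e.1 e.2 end].

Lemma subgraph_cells H G : subgraph H G <-> cells H \subset cells G.
Proof.
split=> [[/subsetP vHG aHG]|/subsetP HG].
  by apply/subsetP => -[x|[x y]]; rewrite !inE; [apply: vHG|apply: aHG].
split; first by apply/subsetP => x xH; have := HG (inl x); rewrite !inE; apply.
by move=> x y xy; have := HG (inr (x, y)); rewrite !inE; apply.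
Qed.

Section Induced.
Variables (G : sgraph V) (S : {set V}).

Definition induced_adj : rel V := [rel x y | [&& x \in S, y \in S & adj G x y]].

Lemma induced_adj_sym : symmetric induced_adj.
Proof. by move=> x y; rewrite /induced_adj /= adj_sym andbCA. Qed.

Lemma induced_adj_irr : irreflexive induced_adj.
Proof. by move=> x; rewrite /induced_adj /= adj_irr !andbF. Qed.

Lemma induced_adj_verts x y : induced_adj x y -> x \in S.
Proof. by case/and3P. Qed.

Definition induced : sgraph V :=
  SGraph induced_adj_sym induced_adj_irr induced_adj_verts.

Lemma induced_subgraph : S \subset verts G -> subgraph induced G.
Proof. by move=> SG; split=> // x y /and3P[]. Qed.

Lemma subgraph_induced H : subgraph H G -> verts H \subset S -> subgraph H induced.
Proof.
move=> [_ aHG] /subsetP HS; split=> [|x y xy]; first exact/subsetP.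
by apply/and3P; split; [apply/HS/(adj_verts xy)|apply/HS/(adj_vertsr xy)|apply: aHG].
Qed.

Lemma path_induced s p :
  {subset s :: p <= S} -> path (adj G) s p -> path (adj induced) s p.
Proof.
by move=> /allP; apply: sub_in_path => x y xS yS xy; apply/and3P.
Qed.

End Induced.

Lemma path_del_vertex G v s p :
  v \notin s :: p -> path (adj G) s p -> path (del_adj G v) s p.
Proof.
move=> vp; apply: (@sub_in_path _ (predC1 v)) => [x y xv yv xy|].
  exact/and3P.
by apply/allP => x xp /=; apply: contraNneq vp => <-.
Qed.

Lemma nonseparableP G :
  nonseparable G <->
  gconnected G /\ forall v, connected_on (del_adj G v) (verts G :\ v).
Proof.
split=> -[conG]; last first.
  by move=> delG; split=> // v [_ [x [y [xG yG _ /negP[]]]]]; apply: delG.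
move=> noncut; split=> // v x y xGv yGv.
have [[xv xG] [yv yG]] := (setD1P xGv, setD1P yGv).
have xy := proj2 conG x y xG yG.
have [vG|vNG] := boolP (v \in verts G).
  by apply/negPn/negP => nxy; apply: (noncut v); split=> //; exists x, y.
apply: connect_sub xy => a b ab; apply/connect1/and3P; split=> //.
  by apply: contraNneq vNG => <-; apply: adj_verts ab.
by apply: contraNneq vNG => <-; apply: adj_vertsr ab.
Qed.

Lemma nonseparable_edge G x y : adj G x y -> nonseparable (induced G [set x; y]).
Proof.
move=> xy; set K := induced G _.
have Kxy : adj K x y by apply/and3P; rewrite !inE !eqxx orbT.
apply/nonseparableP; split=> [|v a b].
  split; first by apply/set0Pn; exists x; rewrite !inE eqxx.
  by move=> a b /set2P[]-> /set2P[]->; rewrite ?connect0 // connect1 // adj_sym.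
case/setD1P=> av /set2P aE /setD1P[bv /set2P bE].
case: aE bE av bv => -> [] -> av bv; rewrite ?connect0 //; apply/connect1/and3P => //.
by rewrite adj_sym.
Qed.

(* A vertex [v] occurs at most once on the path, so one of the two parts cut
   at [c] avoids it. *)
Lemma path_connect_end G v s p c :
    path (adj G) s p -> uniq (s :: p) -> c \in s :: p -> c != v ->
  exists2 h, h \in [set s; last s p] :\ v & connect (del_adj G v) c h.
Proof.
move=> sp up cp cv; case/splitPl: cp sp up => p1 p2 lastp1.
rewrite cat_path last_cat lastp1 => /andP[sp1 cp2] up.
have [vp1|vNp1] := boolP (v \in s :: p1).
  have vNp2 : v \notin c :: p2.
    rewrite inE negb_or eq_sym cv /=; move: up; rewrite -cat_cons cat_uniq.
    by case/and3P=> _ /hasPn p12 _; apply: contraL vp1 => /p12.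
  exists (last c p2); last by apply/connectP; exists p2; rewrite ?path_del_vertex.
  by rewrite !inE eqxx orbT andbT; apply: contraNneq vNp2 => <-; apply: mem_last.
exists s.
  by rewrite !inE eqxx andbT; apply: contraNneq vNp1 => <-; apply: mem_head.
rewrite (sym_connect_sym (@del_adj_sym _ G v)); apply/connectP.
by exists p1; rewrite ?path_del_vertex.
Qed.

Lemma nonseparable_add_path G H x y p :
    subgraph H G -> nonseparable H -> x \in verts H -> y \in verts H ->
    is_path G x y p ->
  nonseparable (induced G (verts H :|: [set z in x :: p])).
Proof.
move=> HG /nonseparableP[[_ conH] delH] xH yH /and4P[_ xp /eqP lastp up].
set S := _ :|: _; set K := induced G S.
have [_ aHK] : subgraph H K by apply: subgraph_induced; rewrite ?subsetUl.
have xpK : path (adj K) x p.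
  by apply: path_induced xp => z zp; rewrite 2!inE zp orbT.
apply/nonseparableP; split=> [|v].
  split; first by apply/set0Pn; exists x; rewrite inE xH.
  apply: connected_on_attach (connected_on_subrel aHK conH) _; first exact: adj_sym.
  move=> z; rewrite 2!inE => /orP[zH|zp]; first by exists z.
  exists x; rewrite // (sym_connect_sym (@adj_sym _ K)).
  exact: path_connect xpK _ zp.
apply: (@connected_on_attach _ _ (verts H :\ v)); first exact: del_adj_sym.
  apply: connected_on_subrel (delH v) => a b /and3P[av bv /aHK ab].
  exact/and3P.
move=> z /setD1P[zv]; rewrite 2!inE => /orP[zH|zp].
  by exists z; rewrite // !inE zv.
have [h] := path_connect_end xpK up zp zv; rewrite lastp => hxy zh.
by exists h => //; move: hxy; rewrite !inE => /andP[-> /pred2P[]->].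
Qed.

Lemma block_exists G H :
  subgraph H G -> nonseparable H -> exists2 B, block B G & subgraph H B.
Proof.
move=> HG nsH.
pose P C := `[< exists K, [/\ subgraph K G, nonseparable K & cells K = C] >].
have [|C /maxsetP[/asboolP[B [BG nsB <-]] maxB] HB] := @maxset_exists _ P (cells H).
  by apply/asboolP; exists H.
exists B; last exact/subgraph_cells.
split=> // K KG nsK /subgraph_cells BK; apply/subgraph_cells.
by rewrite (maxB (cells K)) //; apply/asboolP; exists K.
Qed.

Lemma edge_block G x y :
  adj G x y -> exists2 B, block B G & x \in verts B /\ y \in verts B.
Proof.
move=> xy; have [||B blB [/subsetP sub _]] := @block_exists G (induced G [set x; y]).
- apply/induced_subgraph/subsetP => z /set2P[]->; first exact: adj_verts xy.
  exact: adj_vertsr xy.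
- exact: nonseparable_edge.
by exists B => //; split; apply: sub; rewrite !inE eqxx ?orbT.
Qed.

End Subgraphs.

Section Geodesics.
Variable V : finType.
Implicit Types (G B : sgraph V) (s t w x : V) (p q : seq V).

Lemma is_path_verts G s t p : is_path G s t p -> {subset s :: p <= verts G}.
Proof. by case/and4P=> sG sp _ _; apply: path_verts. Qed.

Lemma is_path_verts_last G s t p : is_path G s t p -> t \in verts G.
Proof.
by move=> stp; have /and4P[_ _ /eqP<- _] := stp; apply/(is_path_verts stp)/mem_last.
Qed.

Lemma is_path_cat G s t p q :
  is_path G s t (p ++ q) -> is_path G s (last s p) p /\ is_path G (last s p) t q.
Proof.
move=> stpq; have /and4P[sG] := stpq; rewrite cat_path last_cat -cat_cons.
case/andP=> sp pq lq upq; have wG : last s p \in verts G.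
  by apply: (is_path_verts stpq); rewrite -cat_cons mem_cat mem_last.
move: (upq); rewrite [in uniq _]lastI cat_rcons.
rewrite !cat_uniq => /and3P[_ _ uq]; move: upq; rewrite cat_uniq => /andP[up _].
by split; apply/and4P.
Qed.

Lemma path_rev G s p :
  path (adj G) s p -> path (adj G) (last s p) (rev (belast s p)).
Proof. by rewrite rev_path; apply: sub_path => x y; rewrite adj_sym. Qed.

Lemma last_rev_belast s p : last (last s p) (rev (belast s p)) = s.
Proof. by case: p => //= x p; rewrite rev_cons last_rcons. Qed.

Lemma is_path_rev G s t p : is_path G s t p -> is_path G t s (rev (belast s p)).
Proof.
move=> stp; have /and4P[_ sp /eqP lp up] := stp.
apply/and4P; split; first exact: is_path_verts_last stp.
- by rewrite -lp path_rev.
- by rewrite -lp last_rev_belast.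
by rewrite -rev_rcons rev_uniq -lp -lastI.
Qed.

Lemma is_path_refl G s p : is_path G s s p -> p = [::].
Proof.
by case: p => // x p /and4P[_ _ /eqP lp /andP[/negP[]]]; rewrite -{1}lp /= mem_last.
Qed.

(* The cycle formed by [x :: p] and [q], without its edge from [s] to [x]. *)
Lemma is_path_close G s t x p q :
    is_path G s t (x :: p) -> is_path G s t q -> ~~ has (mem q) (belast x p) ->
  is_path G s x (q ++ rev (belast x p)).
Proof.
move=> /and4P[_ /andP[_ xp] /eqP lp up] /and4P[sG sq /eqP lq uq] disj.
apply/and4P; split=> //.
- by rewrite cat_path sq lq -lp /= path_rev.
- by rewrite last_cat lq -lp /= last_rev_belast.
rewrite -cat_cons cat_uniq uq rev_uniq has_rev /=.
move: up; rewrite lastI rcons_uniq => /andP[_ /= /andP[sNp ->]]; rewrite andbT.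
apply/hasPn => z zp; rewrite inE negb_or (hasPn disj z zp) andbT.
by apply: contraNneq sNp => <-.
Qed.

Lemma is_path_block B G s t p :
    block B G -> s \in verts B -> t \in verts B ->
  is_path B s t p = is_path G s t p.
Proof.
move=> [BG nsB maxB] sB tB; have [/subsetP vBG aBG] := BG.
apply/idP/idP => stp; have /and4P[sX sp lp up] := stp.
  by apply/and4P; split=> //; [apply: vBG|apply: sub_path sp].
set S := verts B :|: [set z in s :: p].
have [_ aKB] : subgraph (induced G S) B.
  apply: maxB; last by apply: subgraph_induced; rewrite ?subsetUl.
    apply/induced_subgraph/subsetP => z; rewrite 2!inE => /orP[/vBG //|].
    exact: is_path_verts stp z.
  exact: nonseparable_add_path stp.
apply/and4P; split=> //; apply: sub_path aKB _ _ _; apply: path_induced sp => z zp.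
by rewrite 2!inE zp orbT.
Qed.

Lemma disjoint_paths_block G s t x p q :
    is_path G s t (x :: p) -> is_path G s t q -> ~~ has (mem q) (belast x p) ->
  exists2 B, block B G & s \in verts B /\ t \in verts B.
Proof.
move=> stp stq disj; have /and4P[_ /andP[/edge_block[B blB [sB xB]] _] _ _] := stp.
exists B => //; split=> //; have := is_path_close stp stq disj.
rewrite -(is_path_block _ blB) // => /is_path_cat[/is_path_verts_last + _].
by have /and4P[_ _ /eqP-> _] := stq.
Qed.

Lemma dist_gt0 G s t : s != t -> (0 < dist G s t)%N.
Proof.
move=> st; rewrite /dist; have : (0 < #|V|)%N by apply/card_gt0P; exists s.
case: #|V| => // n _ /=; case: existsP => // -[p].
by rewrite tuple0 => /and4P[_ _ /= /eqP eq_st]; rewrite eq_st eqxx in st.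
Qed.

Lemma dist_sym G s t : dist G s t = dist G t s.
Proof.
apply: eq_find => k; apply/existsP/existsP => -[p /is_path_rev stp].
  by exists [tuple of rev (belast s p)].
by exists [tuple of rev (belast t p)].
Qed.

Lemma dist_block B G s t :
  block B G -> s \in verts B -> t \in verts B -> dist B s t = dist G s t.
Proof.
move=> blB sB tB; apply: eq_find => k; apply: eq_existsb => p.
exact: is_path_block.
Qed.

Definition geodesic G s t p : bool := is_path G s t p && (size p == dist G s t).

Lemma geodesicP G s t p :
  reflect (exists2 q : (dist G s t).-tuple V, q \in shortest_paths G s t & p = q)
    (geodesic G s t p).
Proof.
apply: (iffP andP) => [[stp szp]|[q]]; first by exists (Tuple szp); rewrite ?inE.
by rewrite inE => stq ->; rewrite size_tuple.
Qed.

Lemma geodesic_rev G s t p :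
  geodesic G s t p -> geodesic G t s (rev (belast s p)).
Proof.
case/andP=> stp szp; apply/andP; split; first exact: is_path_rev.
by rewrite size_rev size_belast dist_sym.
Qed.

Lemma geodesic_block B G s t p :
    block B G -> s \in verts B -> t \in verts B ->
  geodesic B s t p = geodesic G s t p.
Proof.
by move=> blB sB tB; rewrite /geodesic (is_path_block _ blB) ?(dist_block blB).
Qed.

Lemma geodesic_exists G s t p : is_path G s t p -> exists q, geodesic G s t q.
Proof.
move=> stp; have /and4P[_ _ _ /card_uniqP card_sp] := stp.
have has_path : has (fun k => [exists q : k.-tuple V, is_path G s t q]) (iota 0 #|V|).
  apply/hasP; exists (size p); last by apply/existsP; exists (in_tuple p).
  by rewrite mem_iota (leq_trans _ (max_card (mem (s :: p)))) // card_sp.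
have := nth_find 0 has_path; rewrite nth_iota ?add0n -/(dist G s t).
  by case/existsP=> q stq; exists q; rewrite /geodesic stq size_tuple eqxx.
by rewrite -[X in (_ < X)%N](size_iota 0) -has_find.
Qed.

Lemma dist_le_size G s t p :
  s \in verts G -> path (adj G) s p -> last s p = t -> (dist G s t <= size p)%N.
Proof.
move=> sG; case/shortenP=> q sq uq subq lq.
have leqp : (size q <= size p)%N by apply: uniq_leq_size subq; case/andP: uq.
apply: leq_trans leqp; rewrite leqNgt; apply/negP => ltq.
have stq : is_path G s t q by apply/and4P; split=> //; apply/eqP.
have := before_find 0 ltq; rewrite nth_iota ?add0n => [/existsP[]|].
  by exists (in_tuple q).
apply: leq_trans ltq _; rewrite -[X in (_ <= X)%N](size_iota 0).
exact: find_size.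
Qed.

Lemma geodesic_cat G s t p q :
    geodesic G s t (p ++ q) ->
  geodesic G s (last s p) p /\ geodesic G (last s p) t q.
Proof.
case/andP=> /is_path_cat[swp wtq] /eqP szpq; rewrite /geodesic swp wtq /=.
have [/and4P[sG sp _ _] /and4P[wG wq /eqP lq _]] := (swp, wtq).
have [p' /andP[/and4P[_ sp' /eqP lp' _] /eqP szp']] := geodesic_exists swp.
have [q' /andP[/and4P[_ wq' /eqP lq' _] /eqP szq']] := geodesic_exists wtq.
rewrite !eqn_leq !dist_le_size // !andbT -szp' -szq'; split.
  rewrite -(leq_add2r (size q)) -!size_cat szpq dist_le_size ?last_cat ?lp' //.
  by rewrite cat_path sp' lp'.
rewrite -(leq_add2l (size p)) -!size_cat szpq dist_le_size ?last_cat //.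
by rewrite cat_path sp.
Qed.

End Geodesics.

Local Open Scope ring_scope.

Section LexArgmin.
Variables (T : finType) (K : eqType) (ord : rel K).
Hypotheses (ord_refl : reflexive ord) (ord_trans : transitive ord).
Hypothesis ord_total : total ord.
Implicit Types (A : {set T}) (f g : T -> K).

Definition minimizers A f : {set T} :=
  [set p in A | [forall q in A, ord (f p) (f q)]].

Lemma minimizersP A f p :
  reflect (p \in A /\ {in A, forall q, ord (f p) (f q)}) (p \in minimizers A f).
Proof. by rewrite inE; apply: (iffP andP) => -[pA /forall_inP]. Qed.

Lemma minimizers_exist A f p : p \in A -> exists q, q \in minimizers A f.
Proof.
move=> pA; have [q qA minq] := extremumP f ord_refl ord_trans ord_total pA.
by exists q; apply/minimizersP.
Qed.

Definition lex_argmin A f g : option T :=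
  [pick p in minimizers A f | [forall q in minimizers A f, ord (g p) (g q)]].

Variant lex_argmin_spec A f g : option T -> Type :=
  | LexArgminSome p of p \in A & {in A, forall q, ord (f p) (f q)}
      & {in A, forall q, f q = f p -> ord (g p) (g q)} :
      lex_argmin_spec A f g (Some p)
  | LexArgminNone of A =i pred0 : lex_argmin_spec A f g None.

Lemma lex_argminP A f g : lex_argmin_spec A f g (lex_argmin A f g).
Proof.
rewrite /lex_argmin.
case: pickP => [p /andP[/minimizersP[pA minf] /forall_inP ming]|none].
  constructor=> // q qA eqf; apply: ming; apply/minimizersP; split=> // r rA.
  by rewrite eqf minf.
constructor=> p; apply/negP => /(minimizers_exist f)[q].
move=> /(minimizers_exist g)[r /minimizersP[rmin ming]].
by have /negP[] := negbT (none r); apply/andP; split=> //; apply/forall_inP.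
Qed.

End LexArgmin.

Section Gains.
Variables (R : realType) (V : finType) (Phi : gain_graph R V).
Implicit Types (s t x : V) (p q : seq V).

Lemma path_gain_cat s p q :
  path_gain Phi s (p ++ q) = path_gain Phi s p * path_gain Phi (last s p) q.
Proof. by rewrite /path_gain pairmap_cat big_cat. Qed.

Lemma path_gain_cons s x p :
  path_gain Phi s (x :: p) = gain Phi s x * path_gain Phi x p.
Proof. by rewrite /path_gain /= big_cons. Qed.

Lemma path_gain_rev s p :
  path (adj Phi) s p ->
  path_gain Phi (last s p) (rev (belast s p)) = (path_gain Phi s p)^-1.
Proof.
elim: p s => [|x p IHp] s /=; first by rewrite /path_gain !big_nil invr1.
case/andP=> sx xp; rewrite rev_cons -cats1 path_gain_cat IHp // last_rev_belast.
by rewrite !path_gain_cons /path_gain big_nil mulr1 (gain_inv sx) invfM mulrC.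
Qed.

Definition geodesic_gain_unique s t : Prop := forall p q,
  geodesic Phi s t p -> geodesic Phi s t q -> path_gain Phi s p = path_gain Phi s q.

Lemma geodesic_gain_unique_refl s : geodesic_gain_unique s s.
Proof. by move=> p q /andP[/is_path_refl-> _] /andP[/is_path_refl-> _]. Qed.

Lemma geodesic_gain_unique_sym s t :
  geodesic_gain_unique s t -> geodesic_gain_unique t s.
Proof.
move=> uniq_st p q gp gq; apply: invr_inj.
have [/andP[/and4P[_ tp /eqP lp _] _] /andP[/and4P[_ tq /eqP lq _] _]] := (gp, gq).
rewrite -(path_gain_rev tp) -(path_gain_rev tq) lp lq.
by apply: uniq_st; apply: geodesic_rev.
Qed.

Lemma max_gainE s t :
  max_gain Phi s t = oapp (path_gain Phi s \o val) 0
    (lex_argmin >=%R (shortest_paths Phi s t) 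
       (re_gain Phi s \o val) (im_gain Phi s \o val)).
Proof. by []. Qed.

Lemma min_gainE s t :
  min_gain Phi s t = oapp (path_gain Phi s \o val) 0
    (lex_argmin <=%R (shortest_paths Phi s t) 
       (re_gain Phi s \o val) (im_gain Phi s \o val)).
Proof. by []. Qed.

Lemma max_gain_eq_min_gain s t :
  max_gain Phi s t = min_gain Phi s t <-> geodesic_gain_unique s t.
Proof.
rewrite max_gainE min_gainE.
case: (lex_argminP ge_refl ge_trans ge_total) => [p pS maxre maxim|S0]; last first.
  case: (lex_argminP le_refl le_trans le_total) => [q|_]; first by rewrite S0.
  by split=> // _ p q /geodesicP[r]; rewrite S0.
case: (lex_argminP le_refl le_trans le_total) => [q qS minre minim|S0]; last first.
  by rewrite S0 in pS.
split=> [/= eqpq|]; last by apply; apply/geodesicP; [exists p|exists q].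
suff gainE r : geodesic Phi s t r -> path_gain Phi s r = path_gain Phi s p.
  by move=> r1 r2 /gainE-> /gainE.
case/geodesicP=> {}r rS ->.
move: (maxre r rS) (minre r rS) (maxim r rS) (minim r rS).
rewrite /= /re_gain /im_gain -eqpq => le_rp le_pr.
have eqre : complex.Re (path_gain Phi s r) = complex.Re (path_gain Phi s p).
  by apply/le_anti/andP.
move=> /(_ eqre) le_im /(_ eqre) ge_im.
by apply/eqP; rewrite eq_complex eqre eqxx eq_le le_im ge_im.
Qed.

Lemma geodesic_gain_unique_of_blocks :
    (forall B, block B Phi -> {in verts B &, forall s t, geodesic_gain_unique s t}) ->
  forall s t, geodesic_gain_unique s t.
Proof.
move=> uniqB s t p; have [m] := ubnP (size p).
elim: m s t p => // m IHm s t [|x p] ltpm q gp gq.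
  have /andP[/and4P[_ _ /eqP/= st _] _] := gp.
  by move: gp gq; rewrite -st; apply: geodesic_gain_unique_refl.
have [/hasP[w wp wq]|disj] := boolP (has (mem q) (belast x p)); last first.
  have [/andP[sp _] /andP[sq _]] := (gp, gq).
  have [B blB [sB tB]] := disjoint_paths_block sp sq disj.
  exact: (uniqB B blB s t sB tB).
(* [w] is an inner vertex of [x :: p], so both parts cut at [w] are shorter. *)
move: ltpm gp; rewrite lastI.
case/path.splitP: wp => p1 p2; case/path.splitP: wq gq => q1 q2.
rewrite rcons_cat => gq ltm gp.
have [gp1 gp2] := geodesic_cat gp; have [gq1 gq2] := geodesic_cat gq.
rewrite !path_gain_cat !last_rcons in gp1 gp2 gq1 gq2 *.
rewrite size_cat !size_rcons ltnS in ltm.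
congr (_ * _); [apply: (IHm s w)|apply: (IHm w t)] => //.
  by rewrite size_rcons (leq_trans _ ltm) // addSn addnS !ltnS leq_addr.
by rewrite size_rcons (leq_trans _ ltm) // addSn ltnS leq_addl.
Qed.

End Gains.

Lemma geodesic_gain_unique_block (R : realType) (V : finType) (Phi : gain_graph R V)
    (B : sgraph V) (sB : subgraph B Phi) :
  block B Phi -> {in verts B &, forall s t,
    geodesic_gain_unique (subgain sB) s t <-> geodesic_gain_unique Phi s t}.
Proof.
move=> blB s t sinB tinB; rewrite /geodesic_gain_unique.
split=> uniq_st p q gp gq.
  by apply: uniq_st; rewrite /= (geodesic_block _ blB).
by apply: uniq_st; rewrite -(geodesic_block _ blB).
Qed.

Lemma distance_compatibleP (R : realType) (n : nat) (Phi : gain_graph R 'I_n) :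
  distance_compatible Phi <->
  {in verts Phi &, forall s t, geodesic_gain_unique Phi s t}.
Proof.
split=> [/matrixP eqD s t sPhi tPhi|uniqPhi].
  have lt_unique (u v : 'I_n) : u \in verts Phi -> v \in verts Phi -> (u < v)%N ->
      geodesic_gain_unique Phi u v.
    move=> uPhi vPhi lt_uv; apply/max_gain_eq_min_gain.
    have := eqD (enum_rank_in uPhi u) (enum_rank_in vPhi v).
    rewrite !mxE !enum_rankK_in // /phi_max /phi_min /std_order lt_uv.
    by apply/mulIf; rewrite pnatr_eq0 -lt0n dist_gt0 // neq_ltn lt_uv.
  have [lt_st|lt_ts|/val_inj->] := ltngtP s t.
  - exact: lt_unique.
  - exact/geodesic_gain_unique_sym/lt_unique.
  - exact: geodesic_gain_unique_refl.
apply/matrixP => i j; rewrite !mxE /phi_max /phi_min.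
by rewrite !(max_gain_eq_min_gain _ _ _).2 //; apply: uniqPhi; apply: enum_valP.
Qed.

Theorem theorem6p2 (R : realType) (n : nat) (Phi : gain_graph R 'I_n)
    (conn : gconnected Phi) :
  distance_compatible Phi <->
  (forall (B : sgraph 'I_n) (sB : subgraph B Phi),
     block B Phi -> distance_compatible (subgain sB)).
Proof.
split=> [/distance_compatibleP uniqPhi B sB blB|dcB]; apply/distance_compatibleP.
  have [/subsetP BPhi _] := sB.
  move=> s t sinB tinB; apply/(geodesic_gain_unique_block sB blB) => //.
  by apply: uniqPhi; apply: BPhi.
move=> s t _ _; apply: geodesic_gain_unique_of_blocks => B blB {}s {}t sinB tinB.
have [sB _ _] := blB.
have /distance_compatibleP uniqB := dcB B sB blB.
by apply/(geodesic_gain_unique_block sB blB) => //; apply: uniqB.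
Qed.
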